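(* Let $\Gamma$ be a finite, simple, undirected, connected graph with weights $f:V(\Gamma)\to(0,+\infty)$ and $g:E(\Gamma)\to(0,+\infty)$, and let $1\le N\le |V(\Gamma)|$ be an integer. Let $v_1,v_2\in V(\Gamma)$ be two vertices adjacent via the edge $e_{1,2}\in E(\Gamma)$, and suppose that there exists an $N$-partition of $\Gamma$ for which $v_1$ and $v_2$ belong to the same subgraph. Then for any fixed $\lambda\in[0,1]$ with $\lambda\neq 0$, one can modify the value of $g$ on the edge $e_{1,2}$ so that $v_1$ and $v_2$ belong to the same subgraph of the $N$-partition minimizing $\mathcal{F}_\lambda$; that is, there exists a weight $\tilde g:E(\Gamma)\to(0,+\infty)$ with $\tilde g(e)=g(e)$ for all $e\ne e_{1,2}$ such that, for every $N$-partition $\{\Gamma_k\}$ of $\Gamma$ minimizing the functional $\mathcal{F}_\lambda$ (defined in the context) with $\tilde g$ in place of $g$, $v_1$ and $v_2$ belong to the same $V(\Gamma_k)$ for some $k$.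
   Context: A subgraph $\Gamma_k$ of $\Gamma$ is a graph with $V(\Gamma_k)\subseteq V(\Gamma)$ and $E(\Gamma_k)\subseteq E(\Gamma)$; its boundary is $\partial\Gamma_k=\{e_{i,j}\in E(\Gamma): v_i\in V(\Gamma_k),\ v_j\notin V(\Gamma_k)\}$, where $e_{i,j}=e_{j,i}$ is the edge joining $v_i$ and $v_j$. An $N$-partition of $\Gamma$ is a family $\{\Gamma_k\}_{k=1}^N$ of $N$ connected (nonempty) subgraphs of $\Gamma$ with $\bigcup_k V(\Gamma_k)=V(\Gamma)$ and $V(\Gamma_k)\cap V(\Gamma_h)=\emptyset$ for $k\ne h$. Its cut set is $\mathcal{C}(\{\Gamma_k\})=\bigcup_k\partial\Gamma_k$. For a graph $G$ with vertices in $V(\Gamma)$, its mass is $M(G)=\sum_{v\in V(G)}f(v)$. Set $$P(\{\Gamma_k\})=\sum_{e\in\mathcal{C}(\{\Gamma_k\})}g(e),\qquad \sigma(\{\Gamma_k\})=\sqrt{\sum_{k=1}^N\left(M(\Gamma_k)-\frac{M(\Gamma)}{N}\right)^2},$$ and for $\lambda\in[0,1]$ $$\mathcal{F}_\lambda(\{\Gamma_k\})=\lambda P(\{\Gamma_k\})+(1-\lambda)\sigma(\{\Gamma_k\}).$$ Minimization is among all $N$-partitions of $\Gamma$. *)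

(* Defs.v *)
From mathcomp Require Import all_boot all_order all_algebra.
From mathcomp Require Import reals.

Set Implicit Arguments.
Unset Strict Implicit.
Unset Printing Implicit Defensive.

Import Order.TTheory GRing.Theory Num.Theory.
Local Open Scope ring_scope.

(* The vertices of a graph are a subset of an ambient finite type T, so that a
   graph and its subgraphs live in the same type.  The edge joining u and v is
   the unordered pair [set u; v]; the cardinality condition excludes loops. *)
Record simple_graph (T : finType) := SimpleGraph {
  vertices : {set T};
  edges : {set {set T}};
  edgesP : forall e, e \in edges -> e \subset vertices /\ #|e| = 2%N
}.

Section Graphs.
Variable T : finType.
Implicit Types G H : simple_graph T.

Definition adjacent G : rel T := fun u v => [set u; v] \in edges G.

(* The empty graph is connected in this sense; nonemptiness is required
   separately where it is needed. *)
Definition connected_graph G : Prop :=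
  forall u v, u \in vertices G -> v \in vertices G -> connect (adjacent G) u v.

(* Subgraphs are not required to be induced. *)
Definition subgraph H G : Prop :=
  vertices H \subset vertices G /\ edges H \subset edges G.

Definition boundary G H : {set {set T}} :=
  [set e in edges G |
    [exists u, exists v,
      [&& e == [set u; v], u \in vertices H & v \notin vertices H]]].

Record is_partition G (N : nat) (P : 'I_N -> simple_graph T) : Prop := {
  partition_subgraph : forall k, subgraph (P k) G;
  partition_nonempty : forall k, vertices (P k) != set0;
  partition_connected : forall k, connected_graph (P k);
  partition_cover : \bigcup_(k < N) vertices (P k) = vertices G;
  partition_disjoint : forall k h, k != h ->
    vertices (P k) :&: vertices (P h) = set0
}.

Definition cut_set G (N : nat) (P : 'I_N -> simple_graph T) : {set {set T}} :=
  \bigcup_(k < N) boundary G (P k).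

Definition same_part (N : nat) (P : 'I_N -> simple_graph T) (u v : T) : Prop :=
  exists k, u \in vertices (P k) /\ v \in vertices (P k).

Section Weights.
Variable R : realType.
(* Only the values of f on vertices G and of g on edges G are relevant. *)
Variables (f : T -> R) (g : {set T} -> R).

Definition mass G : R := \sum_(v in vertices G) f v.

Definition cut_weight G (N : nat) (P : 'I_N -> simple_graph T) : R :=
  \sum_(e in cut_set G P) g e.

Definition mass_deviation G (N : nat) (P : 'I_N -> simple_graph T) : R :=
  Num.sqrt (\sum_(k < N) (mass (P k) - mass G / N%:R) ^+ 2).

Definition functional (lambda : R) G (N : nat) (P : 'I_N -> simple_graph T) : R :=
  lambda * cut_weight G P + (1 - lambda) * mass_deviation G P.

Definition minimizing (lambda : R) G (N : nat) (P : 'I_N -> simple_graph T) : Prop :=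
  is_partition G P /\
  forall Q : 'I_N -> simple_graph T, is_partition G Q ->
    functional lambda G P <= functional lambda G Q.

End Weights.
End Graphs.

(* Main.v *)
Require Import Defs.
From mathcomp Require Import all_boot all_order all_algebra.
From mathcomp Require Import reals.

Set Implicit Arguments.
Unset Strict Implicit.
Unset Printing Implicit Defensive.

Import Order.TTheory GRing.Theory Num.Theory.
Local Open Scope ring_scope.

(** Making one edge expensive forces every minimizer to keep it uncut.  An edge
lies in the cut set of a partition exactly when its endpoints lie in different
parts ([uncut_edgeP]).  Hence a partition [Q] with [v1] and [v2] together has a
value [c >= 0] of the functional that is insensitive to the weight of the edge
joining them, whereas a partition that separates them pays at least [lambda]
times that weight ([le_functional_cut]).  As [lambda > 0], the weight can be
taken so large that this exceeds [c], and then no separating partition is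
minimizing. *)

Section CutSets.
Variables (T : finType) (G : simple_graph T) (N : nat).
Variable P : 'I_N -> simple_graph T.

Lemma cut_set_sub_edges : cut_set G P \subset edges G.
Proof.
by apply/bigcupsP => k _; apply/subsetP => e; rewrite inE => /andP[].
Qed.

(** If both endpoints lie in part [k] and the edge left part [h], then the
endpoint in part [h] would force [h = k] by disjointness, so that the other one
would lie in part [h] as well.  Conversely, by covering, some part contains
[u], and the edge leaves that part unless it contains [v]. *)
Lemma uncut_edgeP (u v : T) :
  is_partition G P -> [set u; v] \in edges G ->
  reflect (same_part P u v) ([set u; v] \notin cut_set G P).
Proof.
move=> partP uvE; apply: (iffP idP) => [uncut | [k [uk vk]]].
  have [/subsetP uvG _] := edgesP uvE.
  have := uvG u (set21 u v).
  rewrite -(partition_cover partP) => /bigcupP[k _ uk].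
  exists k; split=> //; apply: contraNT uncut => vk.
  apply/bigcupP; exists k => //; rewrite inE uvE /=.
  by apply/existsP; exists u; apply/existsP; exists v; rewrite eqxx uk vk.
apply/bigcupP => -[h _]; rewrite inE uvE /=.
move=> /existsP[a /existsP[b /and3P[/eqP uv_ab ah bNh]]].
have in_k x : x \in [set a; b] -> x \in vertices (P k).
  by rewrite -uv_ab => /set2P[] ->.
have [hk | hk] := eqVneq h k.
  by move: bNh; rewrite hk in_k // set22.
have /setP/(_ a) := partition_disjoint partP hk.
by rewrite !inE ah in_k // set21.
Qed.

Variables (R : realType) (f : T -> R).

Lemma eq_functional (lambda : R) (g g' : {set T} -> R) :
  {in cut_set G P, g =1 g'} ->
  functional f g lambda G P = functional f g' lambda G P.
Proof.
by move=> eq_g; rewrite /functional /cut_weight (eq_bigr _ eq_g).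
Qed.

Variables (lambda : R) (g : {set T} -> R).
Hypothesis lambda01 : 0 <= lambda <= 1.
Hypothesis g_ge0 : {in edges G, forall e, 0 <= g e}.

Lemma functional_ge0 : 0 <= functional f g lambda G P.
Proof.
have /andP[l0 l1] := lambda01.
rewrite addr_ge0 ?mulr_ge0 ?subr_ge0 ?sqrtr_ge0 //.
by apply: sumr_ge0 => e /(subsetP cut_set_sub_edges)/g_ge0.
Qed.

Lemma le_functional_cut e :
  e \in cut_set G P -> lambda * g e <= functional f g lambda G P.
Proof.
move=> eP; have /andP[l0 l1] := lambda01.
apply: ler_wpDr; first by rewrite mulr_ge0 ?subr_ge0 ?sqrtr_ge0.
rewrite ler_wpM2l // /cut_weight (bigD1 e) //= lerDl.
by apply: sumr_ge0 => e' /andP[/(subsetP cut_set_sub_edges)/g_ge0].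
Qed.

End CutSets.

Theorem theorem3p3 (R : realType) (T : finType) (G : simple_graph T)
    (f : T -> R) (g : {set T} -> R) (N : nat) (v1 v2 : T) (lambda : R)
    (G_connected : connected_graph G)
    (f_gt0 : forall v, v \in vertices G -> 0 < f v)
    (g_gt0 : forall e, e \in edges G -> 0 < g e)
    (N_bounds : (1 <= N <= #|vertices G|)%N)
    (v1_in : v1 \in vertices G) (v2_in : v2 \in vertices G)
    (v12_edge : [set v1; v2] \in edges G)
    (v12_together : exists P : 'I_N -> simple_graph T,
      is_partition G P /\ same_part P v1 v2)
    (lambda_bounds : 0 <= lambda <= 1) (lambda_neq0 : lambda != 0) :
  exists g' : {set T} -> R,
    [/\ forall e, e \in edges G -> 0 < g' e,
        forall e, e \in edges G -> e != [set v1; v2] -> g' e = g e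
      & forall P : 'I_N -> simple_graph T,
          minimizing f g' lambda G P -> same_part P v1 v2].
Proof.
have [Q [partQ Q12]] := v12_together.
have lambda_gt0 : 0 < lambda.
  by rewrite lt_neqAle eq_sym lambda_neq0; case/andP: lambda_bounds.
have g_ge0 : {in edges G, forall e, 0 <= g e} by move=> e /g_gt0/ltW.
pose c := functional f g lambda G Q.
have c_ge0 : 0 <= c by apply: functional_ge0.
(* Cutting the edge then costs [lambda * (c / lambda + 1) = c + lambda > c]. *)
pose g' e := if e == [set v1; v2] then c / lambda + 1 else g e.
have g'_gt0 e : e \in edges G -> 0 < g' e.
  rewrite /g'; case: eqP => [_ _ | _]; last exact: g_gt0.
  by rewrite ltr_wpDl // divr_ge0 // ltW.
exists g'; split=> // [e _ /negPf e12 | P [partP minP]].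
  by rewrite /g' e12.
apply/(uncut_edgeP partP v12_edge)/negP => cut12.
have g'_ge0 : {in edges G, forall e, 0 <= g' e} by move=> e /g'_gt0/ltW.
have Q_uncut : [set v1; v2] \notin cut_set G Q.
  exact/(uncut_edgeP partQ v12_edge).
have Q_val : functional f g' lambda G Q = c.
  apply: eq_functional => e eQ; rewrite /g'.
  by case: eqP eQ Q_uncut => // -> ->.
have := le_trans (le_functional_cut f lambda_bounds g'_ge0 cut12) (minP Q partQ).
rewrite Q_val /g' eqxx mulrDr mulr1 mulrCA divff // mulr1.
by rewrite gerDl leNgt lambda_gt0.
Qed.
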